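(* Let $K$ be an infinite field (of arbitrary characteristic), let $S=K[x_1,\ldots,x_n]$, and let $I\subseteq S$ be an ideal which is either a stable monomial ideal or a squarefree stable monomial ideal. Then the generic initial ideal $\mathrm{Gin}(I)$ of $I$ with respect to the reverse lexicographic order induced by $x_1>x_2>\cdots>x_n$ is a stable monomial ideal.
   Context: For a monomial $u\neq 1$ in $S$, $m(u)=\max\{i : x_i\mid u\}$. A monomial ideal $I$ is stable if $x_i(u/x_{m(u)})\in I$ for every monomial $u\in I$, $u\ne 1$, and every $i<m(u)$. A monomial ideal $I$ generated by squarefree monomials is squarefree stable if for every squarefree monomial $u\in I$, $u\ne 1$, and every $i<m(u)$ with $x_i\nmid u$ one has $x_i(u/x_{m(u)})\in I$. Generic initial ideal: $\mathrm{GL}_n(K)$ acts on $S$ by linear changes of coordinates; for a graded ideal $I$ there is a nonempty Zariski open subset $U\subseteq \mathrm{GL}_n(K)$ such that the initial ideal $\mathrm{in}(gI)$ with respect to the (graded) reverse lexicographic order induced by $x_1>\cdots>x_n$ is the same monomial ideal for all $g\in U$; this ideal is $\mathrm{Gin}(I)$. *)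

(* Defs.v *)
(* Variables are indexed from 0: x_1, ..., x_n are 'X_i for i : 'I_n.  Monomials
   are exponent vectors u : 'X_{1..n}.  Ideals are Prop-valued predicates, since
   the ideals of MathComp's ring_quotient are decidable and exclude the unit
   ideal. *)
From mathcomp Require Import all_boot all_algebra.
From mathcomp Require Import mpoly.

Set Implicit Arguments.
Unset Strict Implicit.
Unset Printing Implicit Defensive.

Import GRing.Theory.

Local Open Scope ring_scope.

Definition infinite_field (K : fieldType) : Prop :=
  forall s : seq K, exists x : K, x \notin s.

Section Ideals.

Context (n : nat) (K : fieldType).
Implicit Types (I J A : {mpoly K[n]} -> Prop) (f h : {mpoly K[n]}).
Implicit Types (u v : 'X_{1..n}) (M : 'X_{1..n} -> Prop) (i j : 'I_n).
Implicit Types (g : 'M[K]_n).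

Definition is_ideal I : Prop :=
  [/\ I 0, forall f h, I f -> I h -> I (f + h) & forall h f, I f -> I (h * f)].

Definition ideal_gen A f : Prop :=
  forall J, is_ideal J -> (forall a, A a -> J a) -> J f.

Definition monomial_span M : {mpoly K[n]} -> Prop :=
  ideal_gen (fun f => exists2 u, M u & f = 'X_[u]).

Definition monomial_ideal I : Prop :=
  exists M, forall f, I f <-> monomial_span M f.

Definition squarefree u : bool := [forall i, (u i <= 1)%N].

Definition squarefree_monomial_ideal I : Prop :=
  exists2 M, (forall u, M u -> squarefree u) &
             forall f, I f <-> monomial_span M f.

(* j is the (unique) index m(u); no j satisfies this when u = 1. *)
Definition is_max_var u j : bool :=
  (0 < u j)%N && [forall k : 'I_n, (0 < u k)%N ==> (k <= j)%N].

(* The truncated subtraction of exponent vectors is exact here, x_{m(u)} being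
   a divisor of u. *)
Definition stable_ideal I : Prop :=
  monomial_ideal I /\
  forall u, I 'X_[u] -> u != 0%MM ->
  forall j, is_max_var u j ->
  forall i, (i < j)%N -> I 'X_[u - U_(j) + U_(i)].

Definition squarefree_stable_ideal I : Prop :=
  squarefree_monomial_ideal I /\
  forall u, squarefree u -> I 'X_[u] -> u != 0%MM ->
  forall j, is_max_var u j ->
  forall i, (i < j)%N -> u i = 0%N -> I 'X_[u - U_(j) + U_(i)].

(* Strict graded reverse lexicographic order for 'X_0 > 'X_1 > ...  The order
   <%O that multinomials puts on 'X_{1..n}, and hence mlead, is graded
   lexicographic, despite what the header of mpoly.v says. *)
Definition degrevlex_lt u v : bool :=
  (mdeg u < mdeg v)%N ||
  (mdeg u == mdeg v) &&
  [exists i : 'I_n, (v i < u i)%N && [forall k : 'I_n, (i < k)%N ==> (u k == v k)]].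

Definition is_initial_monomial f u : Prop :=
  u \in msupp f /\ forall v, v \in msupp f -> v != u -> degrevlex_lt v u.

Definition initial_ideal J : {mpoly K[n]} -> Prop :=
  monomial_span (fun u => exists2 f, J f & is_initial_monomial f u).

(* g sends x_j to \sum_i g_ij x_i, which makes GL_n(K) act on the left. *)
Definition gl_act g f : {mpoly K[n]} :=
  f \mPo [tuple \sum_(i < n) g i j *: 'X_i | j < n].

Definition gl_image g I f : Prop := exists2 h, I h & f = gl_act g h.

(* The complement in GL_n(K) of the common zero set of a family E of
   polynomials in the n * n matrix entries.  Regular functions on GL_n(K) may
   also involve 1 / det, but clearing such denominators leaves the zero sets
   in GL_n(K) unchanged. *)
Definition zariski_open_GL (U : 'M[K]_n -> Prop) : Prop :=
  exists E : {mpoly K[n * n]} -> Prop, forall g,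
    U g <-> g \in unitmx /\ exists2 p, E p & p.@[fun k => mxvec g 0 k] != 0.

(* J = Gin(I). *)
Definition is_generic_initial_ideal I J : Prop :=
  exists U : 'M[K]_n -> Prop,
    [/\ zariski_open_GL U, exists g, U g &
        forall g, U g -> forall f, initial_ideal (gl_image g I) f <-> J f].

End Ideals.

(* Main.v *)
Require Import Defs.
From mathcomp Require Import all_boot all_algebra.
From mathcomp Require Import perm zify boolp.
From mathcomp Require Import mpoly.

(** Fix a degree [d], let [V] be the span of the monomials of degree [d] of
    [I], let [J] be the initial ideal of [gI] for a generic [g], and call a
    monomial outside [J] standard.  Stability of [J] in degree [d] is proved by
    counting the pairs [(j, w)] where [w] is a standard monomial of degree [d]
    in [x_1, ..., x_j].

    Sending [(j, w)] to [x_j w] reaches every monomial of degree [d + 1]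
    outside [J_d S_1]: divide such a monomial by its last variable.  If
    stability fails, so that [x_i u / x_m] is standard for some [u] in [J_d]
    with [m = m(u)] and [i < m], there is one pair more, namely
    [(m, x_i u / x_m)], which is sent to [x_i u] in [J_d S_1].  Now
    [#(J_d S_1) <= dim (V S_1)], since polynomials with distinct initial
    monomials are independent (lemma [shadow_card_le]).  Hence [J] is stable in
    degree [d] as soon as there are at most [dim S_{d+1} / V S_1] pairs
    (lemma [stable_of_std_card]).

    For a fixed [j], the reverse lexicographic order makes the standard
    monomials in [x_1, ..., x_j] independent modulo
    [gV + (x_{j+1}, ..., x_n)], so their number is at most the dimension of the
    quotient (lemma [std_card_le]).  This dimension is upper semicontinuous in
    [g], so it need only be bounded for one invertible [g]: on the line joining
    that matrix to a point of the open set defining [Gin(I)], all but finitely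
    many points are generic enough.  It is therefore enough (lemma
    [stable_criterion]) to find one invertible [h], the inverse of the special
    [g], and for each [j] a set [T_j] of monomials of degree [d] that spans
    [S_d] modulo [V + (h x_{j+1}, ..., h x_n)], together with an injection from
    the pairs [(j, t)], [t] in [T_j], to the monomials of degree [d + 1]
    outside [V S_1].

    If [I] is stable, take [h = 1], let [T_j] consist of the monomials of
    degree [d] in [x_1, ..., x_j] outside [I], and send [(j, t)] to [x_j t].

    If [I] is squarefree stable, take [h x_l = \sum_i a_i^(n-l) x_i] with
    distinct [a_i] and put [c = n - j].  The forms spanned by the [h x_l] with
    [l > j] are the [\sum_i p(a_i) x_i] with [p] a polynomial of degree less
    than [c], so one of them vanishes exactly at any prescribed set of fewer
    than [c] variables.  Rewriting with these forms enlarges supports, moves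
    repeated variables to the right inside a support, and moves variables of
    squarefree monomials to the left.  What remains is the set [T_j] of the
    monomials of degree [d] outside [I] supported in [x_1, ..., x_{j+d-1}]
    whose repeated variables are preceded by at least [c] variables of the
    support.  The injection multiplies [t] by the variable of its support
    preceded by exactly [c] others; if there is none, then [t] is squarefree
    and it is multiplied by [x_{j+d}].  The stability of [I] serves only to
    show that [x_{j+d} t] lies outside [V S_1].

    In the code the variables are indexed from 0. *)

Set Implicit Arguments.
Unset Strict Implicit.
Unset Printing Implicit Defensive.

Import GRing.Theory.

Local Open Scope ring_scope.

(** * Monomials and the reverse lexicographic order *)

Section Order.

Context (n : nat).
Implicit Types (u v w : 'X_{1..n}) (i j : 'I_n).

Lemma drl_irr u : degrevlex_lt u u = false.
Proof.
rewrite /degrevlex_lt ltnn eqxx /=.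
by apply/negbTE/existsPn=> i; rewrite ltnn.
Qed.

Lemma drl_mdeg u v : degrevlex_lt u v -> (mdeg u <= mdeg v)%N.
Proof. by case/orP=> [/ltnW //|/andP[/eqP-> _]]. Qed.

Lemma drl_sameP u v : mdeg u = mdeg v ->
  reflect (exists2 i, (v i < u i)%N & forall k : 'I_n, (i < k)%N -> u k = v k)
          (degrevlex_lt u v).
Proof.
move=> duv; rewrite /degrevlex_lt duv ltnn eqxx /=.
apply: (iffP existsP) => [[i /andP[lti /forallP h]]|[i lti h]]; exists i => //.
  by move=> k ik; apply/eqP; apply: (implyP (h k)).
by rewrite lti; apply/forallP=> k; apply/implyP=> /h ->.
Qed.

Lemma drl_trans : transitive (@degrevlex_lt n).
Proof.
move=> v u w uv vw; have /= duv := drl_mdeg uv; have dvw := drl_mdeg vw.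
have [lt|ge] := ltnP (mdeg u) (mdeg w); first by rewrite /degrevlex_lt lt.
have e1 : mdeg u = mdeg v by lia.
have e2 : mdeg v = mdeg w by lia.
case/(drl_sameP e1): uv => i lti hi; case/(drl_sameP e2): vw => k ltk hk.
apply/(drl_sameP (etrans e1 e2)).
have [ik|ki|/val_inj eik] := ltngtP i k.
- exists k => [|l kl]; first by rewrite hi.
  by rewrite hi ?hk // (ltn_trans ik).
- exists i => [|l il]; first by rewrite -hk.
  by rewrite hi ?hk // (ltn_trans ki).
- by subst k; exists i => [|l il]; [apply: ltn_trans lti | rewrite hi ?hk].
Qed.

Lemma drl_total u v : u != v -> degrevlex_lt u v || degrevlex_lt v u.
Proof.
move=> neq; have [lt|lt|duv] := ltngtP (mdeg u) (mdeg v).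
- by rewrite /degrevlex_lt lt.
- by rewrite [X in _ || X]/degrevlex_lt lt orbT.
have /existsP[i0 ne0] : [exists i, u i != v i].
  rewrite -negb_forall; apply: contra neq => /forallP h.
  by apply/eqP/mnmP=> i; apply/eqP.
case: (arg_maxnP (P := fun i => u i != v i) (fun i : 'I_n => i : nat) ne0) => i nei maxi.
have agree (k : 'I_n) : (i < k)%N -> u k = v k.
  by rewrite ltnNge => /negP h; apply/eqP/negPn/negP=> /maxi.
have [lt|lt|e] := ltngtP (u i) (v i); last by rewrite e eqxx in nei.
  by apply/orP; right; apply/(drl_sameP (esym duv)); exists i => // k /agree.
by apply/orP; left; apply/(drl_sameP duv); exists i.
Qed.

Lemma drl_add2r w u v : degrevlex_lt u v -> degrevlex_lt (u + w)%MM (v + w)%MM.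
Proof.
have [lt|ge] := ltnP (mdeg u) (mdeg v).
  by rewrite {2}/degrevlex_lt !mdegD ltn_add2r lt.
move=> uv; have e : mdeg u = mdeg v by have := drl_mdeg uv; lia.
case/(drl_sameP e): uv => i lti hi.
have e' : mdeg (u + w)%MM = mdeg (v + w)%MM by rewrite !mdegD e.
apply/(drl_sameP e'); exists i => [|k ik]; rewrite !mnmDE ?ltn_add2r //.
by rewrite hi.
Qed.

Lemma drl_max (s : seq 'X_{1..n}) : s != [::] ->
  exists2 m, m \in s & forall v, v \in s -> v != m -> degrevlex_lt v m.
Proof.
elim: s => // x s IH _; case: (eqVneq s [::]) => [->|/IH[m ms hm]].
  by exists x => [|v]; rewrite !inE // => /eqP-> /eqP.
case: (eqVneq m x) => [emx|nmx].
  exists x => [|v]; rewrite !inE ?eqxx // => /orP[/eqP->/eqP//|].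
  by rewrite -emx; apply: hm.
case/orP: (drl_total nmx) => lt.
  exists x => [|v]; rewrite !inE ?eqxx // => /orP[/eqP->/eqP//|vs vx].
  by case: (eqVneq v m) => [->//|/(hm _ vs) /drl_trans]; apply.
by exists m => [|v]; rewrite !inE ?ms ?orbT // => /orP[/eqP->|/hm].
Qed.

Lemma mdegDU u i : mdeg (u + U_(i)) = (mdeg u).+1.
Proof. by rewrite mdegD mdeg1 addn1. Qed.

Lemma submUK u i : (0 < u i)%N -> (u - U_(i) + U_(i))%MM = u.
Proof. by move=> ui; rewrite submK // lep1mP -lt0n. Qed.

Lemma mdegBU u i : (0 < u i)%N -> mdeg (u - U_(i))%MM = (mdeg u).-1.
Proof. by move=> ui; rewrite -[in RHS](submUK ui) mdegDU. Qed.

Lemma mnm_ne0 u i : (0 < u i)%N -> u != 0%MM.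
Proof. by apply: contraTneq => ->; rewrite mnm0E. Qed.

Lemma is_max_varP u j :
  reflect ((0 < u j)%N /\ forall k : 'I_n, (j < k)%N -> u k = 0%N) (is_max_var u j).
Proof.
apply: (iffP andP) => [[uj /forallP h]|[uj h]]; split => //.
  move=> k jk; apply/eqP; rewrite -leqn0 leqNgt; apply/negP=> uk.
  by have /implyP/(_ uk) := h k; lia.
apply/forallP=> k; apply/implyP=> uk; rewrite leqNgt; apply/negP=> /h e.
by rewrite e in uk.
Qed.

Lemma ex_max_var u : u != 0%MM -> exists j, is_max_var u j.
Proof.
move=> u0.
have /existsP[i0 ne0] : [exists i, 0 < u i]%N.
  rewrite -[X in is_true X]negbK negb_exists; apply: contra u0 => /forallP h.
  by apply/eqP/mnmP=> i; apply/eqP; rewrite mnm0E -leqn0 leqNgt.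
case: (arg_maxnP (P := fun i => 0 < u i)%N (fun i : 'I_n => i : nat) ne0) => i nei maxi.
exists i; apply/is_max_varP; split => // k ik.
by apply/eqP; rewrite -leqn0 leqNgt; apply/negP => /maxi /=; lia.
Qed.

Lemma is_max_var_inj u i j : is_max_var u i -> is_max_var u j -> i = j.
Proof.
case/is_max_varP=> ui hi /is_max_varP[uj hj]; apply/val_inj => /=.
have [lt|lt|//] := ltngtP i j; first by rewrite hi in uj.
by rewrite hj in ui.
Qed.

End Order.

(** * Monomial ideals *)

Section Ideals.

Context (n : nat) (K : fieldType).
Implicit Types (u v w : 'X_{1..n}) (i j : 'I_n) (f h : {mpoly K[n]}).
Implicit Types (I J : {mpoly K[n]} -> Prop).

Lemma ideal_sum (J : {mpoly K[n]} -> Prop) (T : eqType) (s : seq T) F :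
  is_ideal J -> (forall x, x \in s -> J (F x)) -> J (\sum_(x <- s) F x).
Proof.
case=> J0 JD _ h; rewrite big_seq; elim/big_rec: _ => // x f xs; apply: JD.
exact: h.
Qed.

Lemma monomial_spanP (M : 'X_{1..n} -> Prop) f :
  monomial_span M f <->
  forall u, u \in msupp f -> exists2 v, M v & (v <= u)%MM.
Proof.
split=> [sf|h J idJ gJ].
  apply: (sf (fun f => forall u, u \in msupp f ->
                exists2 v, M v & (v <= u)%MM)); last first.
    move=> _ [v Mv ->] u; rewrite msuppX inE => /eqP->.
    by exists v => //; apply: lepm_refl.
  split=> [u|g h hg hh u|g h hh u]; first by rewrite mcoeff_msupp mcoeff0 eqxx.
    by move/msuppD_le; rewrite mem_cat => /orP[/hg|/hh].
  case/msuppM_le/allpairsP=> -[a b] /= [_ /hh[v Mv lev] ->]; exists v => //.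
  by apply: lepm_trans lev _; apply: lem_addl.
rewrite [f]mpolyE; apply: ideal_sum => // u /h[v Mv lev].
case: (idJ) => _ _ JM; rewrite -(submK lev) mpolyXD.
rewrite -mul_mpolyC mulrA; apply: JM; apply: gJ; by exists v.
Qed.

Lemma ideal_gen_ideal (A : {mpoly K[n]} -> Prop) : is_ideal (ideal_gen A).
Proof.
split=> [J [] //|f h hf hh J idJ gJ|h f hf J idJ gJ].
  by case: (idJ) => _ JD _; apply: JD; [apply: hf | apply: hh].
by case: (idJ) => _ _ JM; apply: JM; apply: hf.
Qed.

Lemma monomial_spanXP (M : 'X_{1..n} -> Prop) u :
  @monomial_span n K M 'X_[u] <-> exists2 v, M v & (v <= u)%MM.
Proof.
rewrite monomial_spanP; split=> [|h v]; first by apply; rewrite msuppX inE.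
by rewrite msuppX inE => /eqP->.
Qed.

Lemma monomial_idealP I : monomial_ideal I ->
  forall f, I f <-> forall u, u \in msupp f -> I 'X_[u].
Proof.
case=> M IM f; rewrite IM monomial_spanP.
by split=> h u /h; rewrite IM monomial_spanXP.
Qed.

Lemma monomial_ideal_ideal I : monomial_ideal I -> is_ideal I.
Proof.
case=> M IM; have [i0 iD iM] := ideal_gen_ideal (fun f : {mpoly K[n]} => exists2 u, M u & f = 'X_[u]).
split=> [|f h|h f]; rewrite !IM //; [exact: iD | exact: iM].
Qed.

End Ideals.

(** * Linear substitutions *)

Section GLAction.

Context (n : nat) (K : fieldType).
Implicit Types (u v w : 'X_{1..n}) (i j : 'I_n) (f h : {mpoly K[n]}).
Implicit Types (g A B : 'M[K]_n).

(** The linear form to which [g] sends the variable [x_j]. *)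
Definition gl_form g j : {mpoly K[n]} := \sum_(i < n) g i j *: 'X_i.

Lemma gl_actXU g j : gl_act g 'X_j = gl_form g j.
Proof. by rewrite /gl_act comp_mpolyXU -tnth_nth tnth_mktuple. Qed.

Lemma gl_actX g u : gl_act g 'X_[u] = \prod_(i < n) gl_form g i ^+ u i.
Proof.
by rewrite /gl_act comp_mpolyX; apply: eq_bigr => i _; rewrite tnth_mktuple.
Qed.

Lemma gl_actE g f :
  gl_act g f = \sum_(u <- msupp f) f@_u *: \prod_(i < n) gl_form g i ^+ u i.
Proof.
rewrite /gl_act comp_mpolyE; apply: eq_bigr => u _; congr (_ *: _).
by apply: eq_bigr => i _; rewrite tnth_mktuple.
Qed.

Lemma gl_actD g : {morph gl_act g : f h / f + h}.
Proof. by move=> f h; apply: comp_mpolyD. Qed.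

Lemma gl_actM g : {morph gl_act g : f h / f * h}.
Proof. by move=> f h; apply: rmorphM. Qed.

Lemma gl_actZ g c f : gl_act g (c *: f) = c *: gl_act g f.
Proof. exact: comp_mpolyZ. Qed.

Lemma gl_act0 g : gl_act g 0 = 0.
Proof. exact: comp_mpoly0. Qed.

Lemma gl_act_sum g (T : Type) (s : seq T) P F :
  gl_act g (\sum_(x <- s | P x) F x) = \sum_(x <- s | P x) gl_act g (F x).
Proof. exact: raddf_sum. Qed.

Lemma gl_act1 f : gl_act 1%:M f = f.
Proof.
rewrite -[RHS]comp_mpoly_id /gl_act; congr (_ \mPo _).
apply: eq_from_tnth => j; rewrite !tnth_mktuple (bigD1 j) //= mxE eqxx scale1r.
by rewrite big1 ?addr0 // => i /negPf nij; rewrite mxE nij scale0r.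
Qed.

Lemma gl_act_comp A B f : gl_act A (gl_act B f) = gl_act (A *m B) f.
Proof.
rewrite [gl_act B f]gl_actE gl_act_sum gl_actE; apply: eq_bigr => u _.
rewrite gl_actZ; congr (_ *: _); rewrite {1}/gl_act rmorph_prod /=.
apply: eq_bigr => j _; rewrite rmorphXn /=; congr (_ ^+ _).
rewrite -/(gl_act A _) /gl_form gl_act_sum.
under eq_bigr => i _ do rewrite gl_actZ gl_actXU /gl_form scaler_sumr.
rewrite exchange_big /=; apply: eq_bigr => i _; rewrite mxE scaler_suml.
by apply: eq_bigr => k _; rewrite scalerA mulrC.
Qed.

Lemma dhomog_gl_act g d f : f \is d.-homog -> gl_act g f \is d.-homog.
Proof.
move/dhomogP => hf; rewrite gl_actE big_seq; apply: rpred_sum => u /hf /= <-.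
apply: rpredZ; rewrite mdegE.
elim/big_rec2: _ => [|i p e _ he]; first exact: dhomog1.
apply: dhomogM he; rewrite -[X in X.-homog]mul1n; apply: dhomogMn.
apply: rpred_sum => k _; apply: rpredZ; by rewrite dhomogX /= mdeg1.
Qed.

Lemma pihomog_gl_act g d f : pihomog mdeg d (gl_act g f) = gl_act g (pihomog mdeg d f).
Proof.
have le_max : (msize f <= (maxn (msize f) d.+1))%N by apply: leq_maxl.
rewrite {1}(pihomog_partitionE le_max) gl_act_sum raddf_sum /=.
have dlt : (d < maxn (msize f) d.+1)%N by apply: leq_maxr.
rewrite (bigD1 (Ordinal dlt)) //= [X in _ + X]big1 ?addr0 => [|e ne].
  by rewrite pihomog_dE //; apply: dhomog_gl_act; apply: pihomogP.
by rewrite (@pihomog_ne0 _ _ _ e) //; apply: dhomog_gl_act; apply: pihomogP.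
Qed.

Lemma gl_image_ideal g I : g \in unitmx -> is_ideal I -> is_ideal (gl_image g I).
Proof.
move=> ug [I0 ID IM]; split.
- by exists 0; rewrite ?gl_act0.
- by move=> _ _ [f If ->] [h Ih ->]; exists (f + h); rewrite ?gl_actD //; apply: ID.
move=> h _ [f If ->]; exists (gl_act (invmx g) h * f); first exact: IM.
by rewrite gl_actM gl_act_comp mulmxV // gl_act1.
Qed.

End GLAction.

(** * Polynomial functions of one parameter *)

Section PolyFun.

Context (n : nat) (K : fieldType).

(** Functions of a parameter [t] that are given by a polynomial in [t]. *)
Definition polyfun (F : K -> K) := exists q : {poly K}, forall t, F t = q.[t].

Lemma polyfun_cst c : polyfun (fun=> c).
Proof. by exists c%:P => t; rewrite hornerC. Qed.

Lemma polyfun_id : polyfun id.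
Proof. by exists 'X => t; rewrite hornerX. Qed.

Lemma polyfunD F G : polyfun F -> polyfun G -> polyfun (fun t => F t + G t).
Proof. by case=> p hp [q hq]; exists (p + q) => t; rewrite hornerD hp hq. Qed.

Lemma polyfunM F G : polyfun F -> polyfun G -> polyfun (fun t => F t * G t).
Proof. by case=> p hp [q hq]; exists (p * q) => t; rewrite hornerM hp hq. Qed.

Lemma polyfun_sum (T : Type) (s : seq T) P (F : T -> K -> K) :
  (forall x, polyfun (F x)) -> polyfun (fun t => \sum_(x <- s | P x) F x t).
Proof.
move=> hF; elim: s => [|x s IH].
  by exists 0 => t; rewrite big_nil horner0.
have [Px|nPx] := boolP (P x); last first.
  by case: IH => q hq; exists q => t; rewrite big_cons (negPf nPx).
have [q hq] := polyfunD (hF x) IH.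
by exists q => t; rewrite big_cons Px hq.
Qed.

Lemma polyfun_prod (T : Type) (s : seq T) P (F : T -> K -> K) :
  (forall x, polyfun (F x)) -> polyfun (fun t => \prod_(x <- s | P x) F x t).
Proof.
move=> hF; elim: s => [|x s IH].
  by exists 1 => t; rewrite big_nil hornerC.
have [Px|nPx] := boolP (P x); last first.
  by case: IH => q hq; exists q => t; rewrite big_cons (negPf nPx).
have [q hq] := polyfunM (hF x) IH.
by exists q => t; rewrite big_cons Px hq.
Qed.

Lemma polyfunX F e : polyfun F -> polyfun (fun t => F t ^+ e).
Proof. by case=> q hq; exists (q ^+ e) => t; rewrite horner_exp hq. Qed.

Lemma polyfun_det m (A : K -> 'M[K]_m) :
  (forall i j, polyfun (fun t => A t i j)) -> polyfun (fun t => \det (A t)).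
Proof.
move=> hA; apply: polyfun_sum => s; apply: polyfunM; first exact: polyfun_cst.
by apply: polyfun_prod.
Qed.

Lemma polyfun_meval m (p : {mpoly K[m]}) (v : K -> 'I_m -> K) :
  (forall i, polyfun (v^~ i)) -> polyfun (fun t => p.@[v t]).
Proof.
move=> hv; have [|q hq] := @polyfun_sum _ (msupp p) xpredT
    (fun u t => p@_u * \prod_i v t i ^+ u i).
  move=> u; apply: polyfunM; first exact: polyfun_cst.
  by apply: polyfun_prod => i; apply: polyfunX.
by exists q => t; rewrite mevalE hq.
Qed.

Lemma polyfun_gl_act (g : K -> 'M[K]_n) (u w : 'X_{1..n}) :
  (forall i j, polyfun (fun t => g t i j)) ->
  polyfun (fun t => (gl_act (g t) 'X_[u])@_w).
Proof.
move=> hg; pose mpolyfun (F : K -> {mpoly K[n]}) := forall w, polyfun (fun t => (F t)@_w).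
have mM F G : mpolyfun F -> mpolyfun G -> mpolyfun (fun t => F t * G t).
  move=> hF hG m.
  have [|q hq] := @polyfun_sum _ (index_enum _)
    (fun k : 'X_{1..n < (mdeg m).+1, (mdeg m).+1} => m == (k.1 + k.2)%MM)
    (fun k t => (F t)@_k.1 * (G t)@_k.2).
    by move=> k; apply: polyfunM.
  by exists q => t; rewrite mcoeffM hq.
have m1 : mpolyfun (fun=> 1) by move=> m; apply: polyfun_cst.
have mX F e : mpolyfun F -> mpolyfun (fun t => F t ^+ e).
  move=> hF; elim: e => [|e IH]; first exact: m1.
  have := mM _ _ hF IH => h m; have [q hq] := h m.
  by exists q => t; rewrite exprS hq.
have mform j : mpolyfun (fun t => gl_form (g t) j).
  move=> m; have [|q hq] := @polyfun_sum _ (index_enum 'I_n) xpredT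
    (fun i t => g t i j * ('X_i : {mpoly K[n]})@_m).
    by move=> i; apply: polyfunM => //; apply: polyfun_cst.
  by exists q => t; rewrite -hq raddf_sum; apply: eq_bigr => i _; rewrite /= mcoeffZ.
have mprod (s : seq 'I_n) : mpolyfun (fun t => \prod_(i <- s) gl_form (g t) i ^+ u i).
  elim: s => [|i s IH] m.
    by have [q hq] := m1 m; exists q => t; rewrite big_nil (hq t).
  by have [q hq] := mM _ _ (mX _ (u i) (mform i)) IH m; exists q => t; rewrite big_cons hq.
by have [q hq] := mprod (index_enum 'I_n) w; exists q => t; rewrite gl_actX hq.
Qed.

(** Over an infinite field, finitely many polynomial functions, none of them
    identically zero, have a common non-root. *)
Lemma polyfun_avoid (T : eqType) (s : seq T) (F : T -> K -> K) :
  infinite_field K ->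
  (forall x, x \in s -> polyfun (F x)) ->
  (forall x, x \in s -> exists t, F x t != 0) ->
  exists t, forall x, x \in s -> F x t != 0.
Proof.
move=> hK hF h0.
suff [r hr] : exists r : seq K, forall x t, x \in s -> F x t = 0 -> t \in r.
  by have [t ht] := hK r; exists t => x xs; apply: contra ht => /eqP /hr; apply.
elim: s hF h0 => [|x s IH] hF h0; first by exists [::].
have [||r hr] := IH.
- by move=> y ys; apply: hF; rewrite inE ys orbT.
- by move=> y ys; apply: h0; rewrite inE ys orbT.
have [q hq] := hF x (mem_head _ _).
have q0 : q != 0.
  have [t] := h0 x (mem_head _ _); apply: contraNneq => q0.
  by rewrite hq q0 horner0.
have [rs hrs] : exists rs : seq K, forall t, root q t -> t \in rs.
  move: (size q) {-2}q (leqnn (size q)) q0 => m; elim: m => [|m IHm] p sp p0.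
    by move: sp; rewrite leqn0 size_poly_eq0 (negPf p0).
  have [[a ra]|nr] := pselect (exists a, root p a); last first.
    by exists [::] => t rt; case: nr; exists t.
  have /factor_theorem[p' ep] := ra.
  have p'0 : p' != 0 by apply: contraNneq p0 => e; rewrite ep e mul0r.
  have [|rs hrs] := IHm p' _ p'0.
    by move: sp; rewrite ep size_Mmonic ?monicXsubC // size_XsubC addn2.
  exists (a :: rs) => t; rewrite ep rootM root_XsubC inE => /orP[/hrs ->|->//].
  by rewrite orbT.
exists (rs ++ r) => y t; rewrite inE mem_cat => /orP[/eqP->|ys] /[dup] e.
  by rewrite hq => /rootP /hrs ->.
by move/(hr _ _ ys) ->; rewrite orbT.
Qed.

End PolyFun.

(** * Counting independent and spanning families *)

(** A family [f] that is independent modulo a subspace [Z] and lies in the span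
    of [h] modulo [Z] has at most as many members as [h]. *)
Lemma indep_card_le (K : fieldType) (V : lmodType K) (I J : finType)
    (f : I -> V) (h : J -> V) (C : I -> J -> K) (Z : V -> Prop) :
  Z 0 -> (forall a x y, Z x -> Z y -> Z (a *: x + y)) ->
  (forall i, Z (f i - \sum_j C i j *: h j)) ->
  (forall a : I -> K, Z (\sum_i a i *: f i) -> forall i, a i = 0) ->
  (#|I| <= #|J|)%N.
Proof.
move=> Z0 Zlin Zf ind; rewrite leqNgt; apply/negP => lt.
pose M := \matrix_(i < #|I|, j < #|J|) C (enum_val i) (enum_val j).
have : kermx M != 0.
  rewrite kermx_eq0 /row_free neq_ltn; apply/orP; left.
  exact: leq_ltn_trans (rank_leq_col M) lt.
case/rowV0Pn => v /sub_kermxP vM v0.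
pose a i := v 0 (enum_rank i).
suff za : forall i, a i = 0.
  case/eqP: v0; apply/rowP=> i; rewrite mxE -(enum_valK i); exact: za.
apply: ind.
suff -> : \sum_i a i *: f i = \sum_i a i *: (f i - \sum_j C i j *: h j).
  elim/big_rec: _ => // i x _ Zx; exact: Zlin.
under [RHS]eq_bigr => i _ do rewrite scalerBr.
rewrite sumrB [X in _ - X](_ : _ = 0) ?subr0 //.
under eq_bigr => i _ do rewrite scaler_sumr.
rewrite exchange_big /= big1 // => j _.
under eq_bigr => i _ do rewrite scalerA.
rewrite -scaler_suml [X in X *: _](_ : _ = 0) ?scale0r //.
have e : (v *m M) 0 (enum_rank j) = 0 by rewrite vM mxE.
rewrite mxE in e; apply: etrans e.
rewrite [RHS](reindex (@enum_rank I)) /=; last first.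
  by exists enum_val => i _; rewrite ?enum_valK ?enum_rankK.
by apply: eq_bigr => i _; rewrite /a /M mxE !enum_rankK.
Qed.

(** * Initial monomials of a transformed ideal *)

Section Initial.

Context (n : nat) (K : fieldType).
Implicit Types (u v w : 'X_{1..n}) (i j : 'I_n) (f h : {mpoly K[n]}).
Implicit Types (I J : {mpoly K[n]} -> Prop).

(** [u] is the initial monomial of some member of [J]. *)
Definition init_mon J u := exists2 f, J f & is_initial_monomial f u.

Lemma is_initial_monomialMX f u v :
  is_initial_monomial f u -> is_initial_monomial (f * 'X_[v]) (u + v)%MM.
Proof.
case=> uf maxu; split.
  by rewrite (perm_mem (msuppMX _ _)) addmC map_f.
move=> w; rewrite (perm_mem (msuppMX _ _)) => /mapP[m mf ->] ne.
rewrite addmC; apply: drl_add2r; apply: maxu => //.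
by apply: contraNneq ne => ->; rewrite addmC.
Qed.

Lemma initial_idealXP J u : is_ideal J -> initial_ideal J 'X_[u] <-> init_mon J u.
Proof.
case=> _ _ JM; rewrite /initial_ideal monomial_spanXP; split=> [[v [f Jf fv] le]|hu].
  exists (f * 'X_[(u - v)%MM]); first by rewrite mulrC; apply: JM.
  by have := is_initial_monomialMX (u - v)%MM fv; rewrite addmC submK.
by exists u => //; apply: lepm_refl.
Qed.

Lemma mcoeff_pihomog d f u :
  (pihomog mdeg d f)@_u = if mdeg u == d then f@_u else 0.
Proof.
case: eqP => [du|/eqP du]; last by apply: dhomog_nemf_coeff du; apply: pihomogP.
have le : (msize f <= maxn (msize f) d.+1)%N by apply: leq_maxl.
have lt : (d < maxn (msize f) d.+1)%N by apply: leq_maxr.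
have -> : f@_u = \sum_(e < maxn (msize f) d.+1) (pihomog mdeg e f)@_u.
  by rewrite {1}(pihomog_partitionE le) (raddf_sum (mcoeff u)).
rewrite (bigD1 (Ordinal lt)) //=.
rewrite [X in _ + X]big1 ?addr0 // => e ne.
apply: dhomog_nemf_coeff (pihomogP _ _ _) _.
by rewrite /= du; apply: contra ne => /eqP e'; apply/eqP/val_inj.
Qed.

Lemma monomial_ideal_pihomog I d f :
  monomial_ideal I -> I f -> I (pihomog mdeg d f).
Proof.
move=> mI If; apply/(monomial_idealP mI) => u.
rewrite mcoeff_msupp mcoeff_pihomog; case: ifP => [_|]; last by rewrite eqxx.
rewrite -mcoeff_msupp; exact: (proj1 (monomial_idealP mI f)).
Qed.

(** The image of a monomial ideal is homogeneous, so its initial monomials are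
    those of its homogeneous members. *)
Lemma init_mon_homog (g : 'M[K]_n) I u :
  monomial_ideal I -> init_mon (gl_image g I) u ->
  exists h, [/\ I h, h \is (mdeg u).-homog & is_initial_monomial (gl_act g h) u].
Proof.
move=> mI [_ [h Ih ->] [hu hmax]]; exists (pihomog mdeg (mdeg u) h).
split; [exact: monomial_ideal_pihomog | exact: pihomogP |].
rewrite -pihomog_gl_act; split=> [|v].
  by rewrite mcoeff_msupp mcoeff_pihomog eqxx -mcoeff_msupp.
rewrite mcoeff_msupp mcoeff_pihomog; case: ifP => [_|]; last by rewrite eqxx.
by rewrite -mcoeff_msupp; apply: hmax.
Qed.

Lemma ex_initial_monomial f : f != 0 -> exists u, is_initial_monomial f u.
Proof.
by rewrite -msupp_eq0 => /drl_max[u uf hu]; exists u.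
Qed.

(** In a combination, the largest [lm x] with [a x] nonzero does not cancel. *)
Lemma initial_free (T : finType) (lm : T -> 'X_{1..n}) (F : T -> {mpoly K[n]})
    (a : T -> K) :
  injective lm -> (forall x, is_initial_monomial (F x) (lm x)) ->
  \sum_x a x *: F x = 0 -> forall x, a x = 0.
Proof.
move=> lmI hF sF x; apply/eqP; apply: contraT => ax.
have : [seq lm y | y <- enum T & a y != 0] != [::].
  by apply/eqP=> e; suff : lm x \in [::] by []; rewrite -e map_f // mem_filter ax mem_enum.
case/drl_max=> _ /mapP[y +] -> hy; rewrite mem_filter => /andP[ay _].
have /(congr1 (mcoeff (lm y))) := sF.
rewrite raddf_sum /= mcoeff0 (bigD1 y) //= mcoeffZ big1 ?addr0.
  move/eqP; rewrite mulf_eq0 (negPf ay) mcoeff_eq0.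
  by have [-> _] := hF y.
move=> z zy; rewrite mcoeffZ; case: (eqVneq (a z) 0) => [->|az]; first by rewrite mul0r.
have nlm : lm z != lm y by apply: contra zy => /eqP/lmI ->.
have lt : degrevlex_lt (lm z) (lm y).
  by apply: hy nlm; rewrite map_f // mem_filter az mem_enum.
rewrite [_@__](_ : _ = 0) ?mulr0 //; apply: memN_msupp_eq0; apply/negP=> yz.
have [_ /(_ _ yz)] := hF z; rewrite eq_sym => /(_ nlm) /(drl_trans lt).
by rewrite drl_irr.
Qed.

End Initial.

(** Full rank is an open condition: it is detected by the nonvanishing of a
    maximal minor that is nonzero at [t0]. *)
Lemma row_full_generic (K : fieldType) (m p : nat) (A : K -> 'M[K]_(m, p)) t0 :
  (forall i j, polyfun (fun t => A t i j)) -> row_full (A t0) ->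
  exists F, [/\ polyfun F, F t0 != 0 & forall t, F t != 0 -> row_full (A t)].
Proof.
move=> hA full; exists (fun t => \det (rowsub (fullrankfun full) (A t))); split.
- apply: polyfun_det => i j; have [q hq] := hA (fullrankfun full i) j.
  by exists q => t; rewrite mxE.
- by rewrite -unitfE; have := fullrowsub_unit full; rewrite unitmxE.
move=> t; rewrite -unitfE -unitmxE -row_full_unit -!sub1mx => /submx_trans; apply.
by apply/row_subP=> i; rewrite row_rowsub row_sub.
Qed.

(** * A counting criterion for the stability of the generic initial ideal *)

Section Criterion.

Context (n : nat) (K : fieldType).
Implicit Types (u v w z : 'X_{1..n}) (i j l : 'I_n) (f h : {mpoly K[n]}).
Implicit Types (I J : {mpoly K[n]} -> Prop) (T : 'I_n -> 'X_{1..n} -> bool).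

(** [u] involves no variable after [x_j]. *)
Definition in_vars u j : bool := [forall k : 'I_n, (j < k)%N ==> (u k == 0%N)].

Lemma in_varsP u j : reflect (forall k : 'I_n, (j < k)%N -> u k = 0%N) (in_vars u j).
Proof.
apply: (iffP forallP) => h k; first by move=> jk; apply/eqP; apply: (implyP (h k)).
by apply/implyP=> /h ->.
Qed.

(** [z] is a variable times a monomial in [M]. *)
Definition shadow (M : 'X_{1..n} -> Prop) z : Prop :=
  exists2 i, (0 < z i)%N & M (z - U_(i))%MM.

(** Modulo the span of the monomials of degree [d] of [I] and the multiples of
    the images under [h] of the variables after [x_j], every monomial of degree
    [d] is a combination of those in [T j].  Spans are expressed by
    quantification over the linear subspaces [P]. *)
Definition spanning_data I d (h : 'M[K]_n) T : Prop :=
  h \in unitmx /\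
  forall j (P : {mpoly K[n]} -> Prop),
    P 0 -> (forall a x y, P x -> P y -> P (a *: x + y)) ->
    (forall u, mdeg u = d -> T j u -> P 'X_[u]) ->
    (forall u, mdeg u = d -> I 'X_[u] -> P 'X_[u]) ->
    (forall l w, (j < l)%N -> (mdeg w).+1 = d -> P (gl_form h l * 'X_[w])) ->
    forall u, mdeg u = d -> P 'X_[u].

(** [Phi] injects the pairs [(j, u)] with [u] in [T j] of degree [d] into the
    monomials of degree [d + 1] that are not a variable times a monomial of
    [I]. *)
Definition counting_data I d T (Phi : 'I_n -> 'X_{1..n} -> 'X_{1..n}) : Prop :=
  (forall j u, mdeg u = d -> T j u ->
     mdeg (Phi j u) = d.+1 /\ ~ shadow (fun v => I 'X_[v]) (Phi j u)) /\
  (forall j u j' u', mdeg u = d -> T j u -> mdeg u' = d -> T j' u' ->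
     Phi j u = Phi j' u' -> j = j' /\ u = u').

Section Bounded.

Context (d : nat).
Local Notation Mon := 'X_{1..n < d.+2}.

(** Sets of monomials are taken in the finite type of the monomials of degree at
    most [d + 1]; [monb] sends larger degrees to the monomial 1. *)
Definition monb u : Mon := insubd (@bm0 n d.+1) u.

Lemma monbK u : (mdeg u < d.+2)%N -> monb u = u :> 'X_{1..n}.
Proof. by move=> h; rewrite /monb val_insubd h. Qed.

Lemma monbV (u : Mon) : monb u = u.
Proof. by apply: val_inj; rewrite /= monbK // bmdeg. Qed.

Lemma card_subset (S : {set Mon}) : #|S| = #|{: {w | w \in S}}|.
Proof. by rewrite card_sig; apply: eq_card. Qed.

(** The monomials of degree [d] in the variables up to [x_j]. *)
Definition cells j : {set Mon} := [set w : Mon | (mdeg w == d) && in_vars w j].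
(** The monomials of degree [d] that lie in [T j] or in [I]. *)
Definition gens I T j : {set Mon} :=
  [set u : Mon | (mdeg u == d) && (T j u || `[< I 'X_[u] >])].

(** The coordinates of [f] modulo the variables after [x_j], in degree [d]. *)
Definition coords j f : 'rV[K]_#|{: {w | w \in cells j}}| :=
  \row_k f@_(val (val (enum_val k : {w | w \in cells j}))).

Lemma coords_lin j a f h : coords j (a *: f + h) = a *: coords j f + coords j h.
Proof. by apply/rowP=> k; rewrite !mxE mcoeffD mcoeffZ. Qed.

Lemma coords0 j : coords j 0 = 0.
Proof. by apply/rowP=> k; rewrite !mxE mcoeff0. Qed.

(** The coordinates of the images under [g] of the monomials in [gens]. *)
Definition gen_mx I T j (g : 'M[K]_n) : 'M[K]_(#|{: {u | u \in gens I T j}}|, #|{: {w | w \in cells j}}|) :=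
  \matrix_(r, k) (gl_act g 'X_[val (val (enum_val r : {u | u \in gens I T j}))])@_(val (val (enum_val k : {w | w \in cells j}))).

(** Applying the inverse of [h] to [spanning_data] turns the forms in the
    variables after [x_j], which then have zero coordinates. *)
Lemma gen_mx_full I (h : 'M[K]_n) T j : spanning_data I d h T -> row_full (gen_mx I T j (invmx h)).
Proof.
case=> uh span; pose g := invmx h.
pose P f := (coords j (gl_act g f) <= gen_mx I T j g)%MS.
have P0 : P 0 by rewrite /P gl_act0 coords0 sub0mx.
have Plin a x y : P x -> P y -> P (a *: x + y).
  move=> Px Py; rewrite /P gl_actD gl_actZ coords_lin.
  by apply: addmx_sub => //; apply: scalemx_sub.
have Pgen u : mdeg u = d -> T j u || `[< I 'X_[u] >] -> P 'X_[u].
  move=> du hu.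
  have bu : monb u = u :> 'X_{1..n} by apply: monbK; lia.
  have pu : monb u \in gens I T j by rewrite inE bu du eqxx.
  pose r : {w | w \in gens I T j} := exist _ (monb u) pu.
  rewrite /P (_ : coords _ _ = row (enum_rank r) (gen_mx I T j g)) ?row_sub //.
  by apply/rowP=> k; rewrite !mxE enum_rankK /= bu.
have PX u : mdeg u = d -> P 'X_[u].
  apply: (span j P) => // [v dv Tv|v dv Iv|l w jl dw].
  - by apply: Pgen; rewrite // Tv.
  - by apply: Pgen => //; apply/orP; right; apply/asboolP.
  rewrite /P gl_actM -gl_actXU gl_act_comp mulVmx // gl_act1.
  rewrite (_ : coords _ _ = 0) ?sub0mx //; apply/rowP=> k; rewrite !mxE mulrC.
  apply: memN_msupp_eq0; rewrite (perm_mem (msuppMX _ _)).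
  apply/mapP=> -[m _ e]; have := valP (enum_val k); rewrite inE => /andP[_ /in_varsP/(_ l jl)].
  by rewrite e mnmDE mnm1E eqxx.
rewrite -sub1mx; apply/row_subP=> k; rewrite row1.
set w : Mon := val (enum_val k).
have : w \in cells j by apply: valP (enum_val k).
rewrite inE => /andP[/eqP dw _].
have : P (gl_act h 'X_[w]).
  have := dhomog_gl_act h (_ : 'X_[w] \is d.-homog); rewrite dhomogX /= dw eqxx => /(_ isT).
  move/dhomogP => hom; rewrite [gl_act h _]mpolyE big_seq.
  elim/big_rec: _ => // u x /hom du; apply: Plin; exact: PX.
rewrite /P gl_act_comp mulVmx // gl_act1 (_ : coords _ _ = delta_mx 0 k) //.
apply/rowP=> k'; rewrite !mxE eqxx /= mcoeffX eq_sym; congr (_%:R : K).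
by rewrite /w -bmeqP !(inj_eq val_inj) (inj_eq enum_val_inj).
Qed.

(** The standard monomials of degree [d] in the variables up to [x_j]: those
    that are not initial monomials of the transformed ideal. *)
Definition stds I g j : {set Mon} :=
  [set w : Mon | [&& mdeg w == d, in_vars w j &
                   ~~ `[< init_mon (gl_image g I) w >]]].
(** The monomials of degree [d] in [T j]. *)
Definition norms T j : {set Mon} := [set u : Mon | (mdeg u == d) && T j u].

(** If a member of the transformed ideal agrees, modulo the variables after
    [x_j], with a nonzero combination of standard monomials, then its initial
    monomial is one of these, since in the reverse lexicographic order every
    monomial of degree [d] divisible by a later variable is smaller than those
    in the variables up to [x_j].  Hence the standard monomials are independent
    modulo the transformed ideal and the later variables. *)
Lemma std_card_le I T j g :
  is_ideal I -> g \in unitmx -> row_full (gen_mx I T j g) ->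
  (#|stds I g j| <= #|norms T j|)%N.
Proof.
move=> idI ug full; have [J0 JD JM] := gl_image_ideal ug idI.
pose Z f := exists2 h, gl_image g I h /\ h \is d.-homog &
  forall w, mdeg w = d -> in_vars w j -> f@_w = h@_w.
have Z0 : Z 0 by exists 0; rewrite ?rpred0.
have Zlin a x y : Z x -> Z y -> Z (a *: x + y).
  move=> [h [Jh hh] ex] [h' [Jh' hh'] ey]; exists (a *: h + h').
    split; last by apply: rpredD => //; apply: rpredZ.
    by apply: JD => //; rewrite -mul_mpolyC; apply: JM.
  by move=> w dw vw; rewrite !mcoeffD !mcoeffZ ex ?ey.
have comb w : mdeg w = d -> in_vars w j -> exists C : 'X_{1..n} -> K,
    Z ('X_[w] - \sum_(u : {w | w \in norms T j}) C (val u) *: gl_act g 'X_[val u]).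
  move=> dw vw.
  have [c hc] : exists c, coords j 'X_[w] = c *m gen_mx I T j g.
    by apply/submxP; apply: submx_full.
  pose a (u : Mon) := if insub u is Some r then c 0 (enum_rank r) else 0.
  have aE (r : {u | u \in gens I T j}) : a (val r) = c 0 (enum_rank r).
    by rewrite /a valK.
  (* The generators in [T j] give the combination; the others lie in [I], and
     their images make up the member of the transformed ideal. *)
  exists (fun u => a (monb u)).
  pose F (u : Mon) := a u *: gl_act g 'X_[u].
  exists (\sum_(u in gens I T j | ~~ T j u) F u).
    split; last first.
      apply: rpred_sum => u /andP[]; rewrite inE => /andP[du _] _.
      by apply: rpredZ; apply: dhomog_gl_act; rewrite dhomogX.
    elim/big_rec: _ => // u x /andP[]; rewrite inE => /andP[_ /orP[->//|/asboolP Iu]] _.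
    by apply: JD; rewrite /F -mul_mpolyC; apply: JM; exists 'X_[u].
  move=> w' dw' vw'.
  have bw : monb w' = w' :> 'X_{1..n} by apply: monbK; lia.
  have pw : monb w' \in cells j by rewrite inE bw dw' eqxx.
  have ew : ('X_[w] : {mpoly K[n]})@_w' = (\sum_(u in gens I T j) F u)@_w'.
    rewrite (big_sub (gens I T j) F) raddf_sum /=.
    have := congr1 (fun r : 'rV_#|{: {w | w \in cells j}}| =>
      r 0 (enum_rank (exist _ (monb w') pw : {w | w \in cells j}))) hc.
    rewrite !mxE enum_rankK /= bw => ->.
    rewrite [LHS](reindex (@enum_rank _)) /=; last first.
      by exists enum_val => i _; rewrite ?enum_valK ?enum_rankK.
    by apply: eq_bigr => r _; rewrite mxE /F mcoeffZ aE !enum_rankK /= bw.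
  rewrite mcoeffB ew -mcoeffB.
  rewrite (bigID (fun u : Mon => T j u)) /= addrC -addrA.
  rewrite [X in (_ + X)@__](_ : _ = 0) ?addr0 //; apply/eqP; rewrite subr_eq0; apply/eqP.
  rewrite -(big_sub (norms T j) (fun u : Mon => a (monb u) *: gl_act g 'X_[u])).
  apply: eq_big => [u|u _]; last by rewrite monbV.
  by rewrite !inE; case: (T j u); rewrite ?andbT ?andbF.
have combT w : exists C : 'X_{1..n} -> K, mdeg w = d -> in_vars w j ->
    Z ('X_[w] - \sum_(u : {w | w \in norms T j}) C (val u) *: gl_act g 'X_[val u]).
  have [/andP[/eqP dw vw]|h] := boolP ((mdeg w == d) && in_vars w j).
    by have [C hC] := comb w dw vw; exists C.
  by exists (fun=> 0) => dw vw; rewrite dw eqxx vw in h.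
have [C hC] := choice combT.
rewrite [X in (X <= _)%N]card_subset [X in (_ <= X)%N]card_subset.
pose fX (w : {w | w \in stds I g j}) : {mpoly K[n]} := 'X_[val w].
pose hX (u : {u | u \in norms T j}) := gl_act g 'X_[val u].
pose CX (w : {w | w \in stds I g j}) (u : {u | u \in norms T j}) := C (val w) (val u).
apply: (@indep_card_le _ _ _ _ fX hX CX Z) => //.
  move=> w; have := valP w; rewrite inE => /and3P[/eqP dw vw _]; exact: hC.
move=> a [h [Jh hh] eh].
pose f : {mpoly K[n]} := \sum_(w : {w | w \in stds I g j}) a w *: 'X_[val w].
have fE (w : {w | w \in stds I g j}) : f@_(val w) = a w.
  rewrite raddf_sum (bigD1 w) //= mcoeffZ mcoeffX eqxx mulr1 big1 ?addr0 // => w' ne.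
  by rewrite mcoeffZ mcoeffX -bmeqP (inj_eq val_inj) (negPf ne) mulr0.
have f0 w : (forall w' : {w | w \in stds I g j}, w != val w') -> f@_w = 0.
  move=> ne; rewrite raddf_sum big1 // => w' _ /=.
  by rewrite mcoeffZ mcoeffX eq_sym (negPf (ne w')) mulr0.
move=> w; have := valP w; rewrite inE => /and3P[/eqP dw vw nw].
apply/eqP; apply: contraT => aw.
have hw : val (val w) \in msupp h by rewrite mcoeff_msupp -eh // -/f fE.
have [u [uh umax]] : exists u, is_initial_monomial h u.
  by apply: ex_initial_monomial; apply: contraTneq hw => ->; rewrite msupp0.
have du : mdeg u = d by move/dhomogP: hh => /(_ _ uh).
(* [val w] is in the variables up to [x_j] and at most [u], so [u] is too. *)
have vu : in_vars u j.
  have [<- //|ne] := eqVneq (val (val w)) u.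
  have := umax _ hw ne; move/(drl_sameP (etrans dw (esym du))) => [i lti hi].
  have ij : (i <= j)%N.
    by rewrite leqNgt; apply/negP=> /(in_varsP _ _ vw) e; rewrite e in lti.
  apply/in_varsP=> k jk; rewrite -hi ?(leq_ltn_trans ij) //.
  exact: (in_varsP _ _ vw).
have Ju : init_mon (gl_image g I) u by exists h.
move: uh; rewrite mcoeff_msupp -eh // -/f f0 ?eqxx // => w'.
have := valP w'; rewrite inE => /and3P[_ _]; apply: contraNneq => <-; exact/asboolP.
Qed.

(** The monomials of degree [d + 1] that are a variable times a monomial in [M]. *)
Definition shadow_set (M : 'X_{1..n} -> Prop) : {set Mon} :=
  [set z : Mon | (mdeg z == d.+1) && `[< shadow M z >]].

(** Each monomial of degree [d + 1] in the shadow of the initial monomials is the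
    initial monomial of the image of a combination of monomials in the shadow
    of [I]. *)
Lemma shadow_card_le I g :
  monomial_ideal I -> g \in unitmx ->
  (#|shadow_set (init_mon (gl_image g I))| <= #|shadow_set (fun v => I 'X_[v])|)%N.
Proof.
move=> mI ug; set shJ := shadow_set (init_mon _); set shI := shadow_set _.
have ex (z : {z | z \in shJ}) : exists p : {mpoly K[n]},
    is_initial_monomial (gl_act g p) (val z) /\
    p = \sum_(u : {u | u \in shI}) p@_(val u) *: 'X_[val u].
  have := valP z; rewrite inE => /andP[/eqP dz /asboolP[i zi Jz]].
  have [h [Ih hh hz]] := init_mon_homog mI Jz.
  exists (h * gl_form (invmx g) i); split.
    rewrite gl_actM -gl_actXU gl_act_comp mulmxV // gl_act1.
    by rewrite -[bmnm (val z)](submUK zi); apply: is_initial_monomialMX.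
  set p := h * _.
  have hp v : v \in msupp p -> mdeg v = d.+1 /\ shadow (fun v => I 'X_[v]) v.
    move/msuppM_le/allpairsP => [[a b] /= [ah bf ->]].
    have [k ek] : exists k, b = U_(k)%MM.
      have /msupp_sum_le/flatten_mapP[k _ /msuppZ_le] := bf.
      by rewrite msuppX inE => /eqP ->; exists k.
    rewrite ek mdegDU; split.
      by move/dhomogP: hh => /(_ _ ah) /= ->; rewrite mdegBU // dz.
    exists k; first by rewrite mnmDE mnm1E eqxx addn1.
    by rewrite addmK; apply: (proj1 (monomial_idealP mI h)).
  rewrite -(big_sub shI (fun u : Mon => p@_u *: 'X_[u])) [LHS](@mpolywE _ _ d.+2) //.
    rewrite [RHS]big_mkcond; apply: eq_bigr => u _; case: ifPn => // nu.
    rewrite memN_msupp_eq0 ?scale0r //; apply: contra nu => /hp[du su].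
    by rewrite inE du eqxx; apply/asboolP.
  rewrite msizeE; apply/bigmax_leqP_seq => v vp _; have [-> _] := hp _ vp.
  by [].
have [p hp] := choice ex.
rewrite [X in (X <= _)%N]card_subset [X in (_ <= X)%N]card_subset.
pose F (z : {z | z \in shJ}) := gl_act g (p z).
pose hX (u : {u | u \in shI}) := gl_act g 'X_[val u].
pose CX (z : {z | z \in shJ}) (u : {u | u \in shI}) := (p z)@_(val u).
apply: (@indep_card_le _ _ _ _ F hX CX (eq^~ 0)) => //.
- by move=> a x y -> ->; rewrite scaler0 addr0.
- move=> z; have [_ e] := hp z; apply/eqP; rewrite subr_eq0; apply/eqP.
  by rewrite /F {1}e gl_act_sum; apply: eq_bigr => u _; rewrite gl_actZ.
move=> a; pose lm (z : {z | z \in shJ}) : 'X_{1..n} := val z.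
apply: (initial_free (lm := lm)).
  by move=> z z' /val_inj/val_inj.
by move=> z; have [] := hp z.
Qed.

Lemma card_fibers (Q : 'I_n -> {set Mon}) :
  #|[set p : 'I_n * Mon | p.2 \in Q p.1]| = (\sum_j #|Q j|)%N.
Proof.
rewrite -sum1dep_card (eq_bigl (fun p => xpredT p.1 && (p.2 \in Q p.1))) //.
rewrite -(pair_big_dep xpredT (fun j (w : Mon) => w \in Q j) (fun _ _ => 1%N)) /=.
by apply: eq_bigr => j _; rewrite sum1_card.
Qed.

(** If stability fails at [u], the map sending [(j, w)] with [w] standard to
    [x_j w] has too large an image. *)
Lemma stable_of_std_card I g T Phi :
  monomial_ideal I -> g \in unitmx -> counting_data I d T Phi ->
  (forall j, (#|stds I g j| <= #|norms T j|)%N) ->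
  forall u, mdeg u = d -> init_mon (gl_image g I) u ->
  forall j, is_max_var u j ->
  forall i, (i < j)%N -> init_mon (gl_image g I) (u - U_(j) + U_(i))%MM.
Proof.
move=> mI ug [Phi_out Phi_inj] le_std u du Ju j uj i ij; apply: contrapT => nJ.
have [uj0 uj1] := is_max_varP _ _ uj.
set J := gl_image g I in Ju nJ.
pose Md := [set z : Mon | mdeg z == d.+1].
pose shI := shadow_set (fun v => I 'X_[v]); pose shJ := shadow_set (init_mon J).
have sub M : shadow_set M \subset Md.
  by apply/subsetP=> z; rewrite !inE => /andP[].
pose SS := [set p : 'I_n * Mon | p.2 \in stds I g p.1].
pose TT := [set p : 'I_n * Mon | p.2 \in norms T p.1].
have le1 : (#|SS| <= #|TT|)%N by rewrite !card_fibers; apply: leq_sum => k _.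
have le2 : (#|TT| <= #|Md :\: shI|)%N.
  rewrite -(card_in_imset (f := fun p : 'I_n * Mon => monb (Phi p.1 p.2))).
    apply/subset_leq_card/subsetP=> _ /imsetP[[k t] + ->]; rewrite !inE /=.
    case/andP=> /eqP dt Tt; have [dP nP] := Phi_out _ _ dt Tt.
    rewrite monbK ?dP ?ltnSn // eqxx /= andbT; exact/asboolP.
  move=> [k t] [k' t']; rewrite !inE /= => /andP[/eqP dt Tt] /andP[/eqP dt' Tt'].
  move/(congr1 val) => /=; rewrite !monbK; last 2 first.
  - by have [-> _] := Phi_out _ _ dt' Tt'.
  - by have [-> _] := Phi_out _ _ dt Tt.
  by case/(Phi_inj _ _ _ _ dt Tt dt' Tt') => -> /val_inj ->.
have le3 : (#|Md :\: shI| <= #|Md :\: shJ|)%N.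
  rewrite !cardsD !(setIidPr (sub _)); apply: leq_sub2l; exact: shadow_card_le.
pose z0 := monb (u + U_(i))%MM.
have z0E : z0 = (u + U_(i))%MM :> 'X_{1..n} by rewrite monbK // mdegDU du.
have z0J : z0 \notin Md :\: shJ.
  rewrite !inE z0E mdegDU du eqxx /= andbT negbK; apply/asboolP.
  by exists i; rewrite ?addmK // mnmDE mnm1E eqxx addn1.
suff : (#|z0 |: (Md :\: shJ)| <= #|SS|)%N by rewrite cardsU1 z0J; lia.
(* [psi] reaches all of [Md :\: shJ], and [z0] besides. *)
pose psi (p : 'I_n * Mon) := monb (p.2 + U_(p.1))%MM.
apply: leq_trans (leq_imset_card psi (mem SS)).
apply/subset_leq_card/subsetP => z; rewrite in_setU1 => /orP[/eqP ->|].
  have dw : mdeg (u - U_(j) + U_(i))%MM = d.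
    by rewrite mdegDU mdegBU // du; have := mdegBU uj0; have := mdegDU (u - U_(j))%MM j; rewrite submUK // du; lia.
  apply/imsetP; exists (j, monb (u - U_(j) + U_(i))%MM).
    rewrite !inE /= monbK ?dw // eqxx /=; apply/andP; split; last exact/asboolP.
    apply/in_varsP=> k jk; rewrite mnmDE mnmBE uj1 // !mnm1E.
    have /negPf -> : i != k by apply: contraTneq jk => <-; rewrite -leqNgt ltnW.
    by rewrite addn0 sub0n.
  rewrite /psi /= monbK ?dw // /z0; congr monb.
  by rewrite -addmA [(U_(i) + _)%MM]addmC addmA submUK.
rewrite !inE => /andP[]; case: (eqVneq (mdeg z) d.+1) => // dz /= nz _.
have [k zk] : exists k, is_max_var z k.
  by apply: ex_max_var; rewrite -mdeg_eq0 dz.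
have [zk0 zk1] := is_max_varP _ _ zk.
have dw : mdeg (z - U_(k))%MM = d by rewrite mdegBU // dz.
apply/imsetP; exists (k, monb (z - U_(k))%MM).
  rewrite !inE /= monbK ?dw // eqxx /=; apply/andP; split.
    by apply/in_varsP=> l kl; rewrite mnmBE zk1.
  by apply: contra nz => /asboolP h; apply/asboolP; exists k.
by rewrite /psi /= monbK ?dw // submUK // monbV.
Qed.

End Bounded.

Lemma stable_criterion I (Gin : {mpoly K[n]} -> Prop) d (h : 'M[K]_n) T Phi :
  infinite_field K -> monomial_ideal I ->
  spanning_data I d h T -> counting_data I d T Phi ->
  is_generic_initial_ideal I Gin ->
  forall u, mdeg u = d -> Gin 'X_[u] ->
  forall j, is_max_var u j ->
  forall i, (i < j)%N -> Gin 'X_[u - U_(j) + U_(i)].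
Proof.
move=> hK mI span count [U [[E UE] [g1 Ug1] GinU]].
have idI := monomial_ideal_ideal mI.
have [ug1 [p Ep pg1]] := proj1 (UE g1) Ug1.
(* The line joining [g1] (at t = 0) to the inverse of [h] (at t = 1). *)
pose g t := g1 + t *: (invmx h - g1).
have gE : g 0 = g1 by rewrite /g scale0r addr0.
have gE' : g 1 = invmx h by rewrite /g scale1r addrC subrK.
have gpoly k l : polyfun (fun t => g t k l).
  have [q hq] := polyfunD (polyfun_cst (g1 k l))
    (polyfunM (polyfun_id K) (polyfun_cst ((invmx h - g1) k l))).
  by exists q => t; rewrite -hq !mxE.
have exF (j : 'I_n) : exists F, [/\ polyfun F, F 1 != 0 &
    forall t, F t != 0 -> row_full (gen_mx d I T j (g t))].
  apply: row_full_generic; last by rewrite gE'; apply: gen_mx_full.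
  move=> r k; have [q hq] := polyfun_gl_act
    (val (val (enum_val r : {u | u \in gens d I T j})))
    (val (val (enum_val k : {w | w \in cells d j}))) gpoly.
  by exists q => t; rewrite -hq mxE.
have [F hF] := choice exF.
pose G (x : option (option 'I_n)) t := match x with
  | None => \det (g t)
  | Some None => p.@[fun k => mxvec (g t) 0 k]
  | Some (Some j) => F j t
  end.
have [||t Gt] := @polyfun_avoid K _ (enum {: option (option 'I_n)}) G hK.
- move=> [[j|]|] _ /=; first by have [] := hF j.
    apply: polyfun_meval => k; case/mxvec_indexP: k => k l.
    by have [q hq] := gpoly k l; exists q => t; rewrite mxvecE.
  exact: polyfun_det.
- move=> [[j|]|] _ /=; first by exists 1; have [] := hF j.
    by exists 0; rewrite gE.
  by exists 0; rewrite gE -unitfE -unitmxE.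
have ugt : g t \in unitmx.
  by have := Gt None; rewrite mem_enum unitmxE unitfE => /(_ isT).
have Ut : U (g t).
  apply/UE; split => //; exists p => //.
  by have := Gt (Some None); rewrite mem_enum => /(_ isT).
have GinE u : Gin 'X_[u] <-> init_mon (gl_image (g t) I) u.
  rewrite -(GinU _ Ut); apply: initial_idealXP; exact: gl_image_ideal.
move=> u du /GinE Ju j uj i ij; apply/GinE.
apply: (stable_of_std_card mI ugt count) => // k.
apply: std_card_le => //; have [_ _] := hF k; apply.
by have := Gt (Some (Some k)); rewrite mem_enum => /(_ isT).
Qed.

End Criterion.

(** * Stable ideals *)

Section Stable.

Context (n : nat) (K : fieldType) (I : {mpoly K[n]} -> Prop).
Implicit Types (u v w z : 'X_{1..n}) (i j l : 'I_n).

(** The set [T j] for a stable ideal. *)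
Definition stable_norm j u : bool := in_vars u j && ~~ `[< I 'X_[u] >].

Lemma stable_spanning d : spanning_data I d 1%:M stable_norm.
Proof.
split=> [|j P P0 Plin PT PI PY u du]; first exact: unitmx1.
have [Iu|nIu] := pselect (I 'X_[u]); first exact: PI.
have [vu|] := boolP (in_vars u j).
  by apply: PT => //; rewrite /stable_norm vu; apply/asboolP.
rewrite negb_forall => /existsP[l]; rewrite negb_imply -lt0n => /andP[jl ul].
rewrite -(submUK ul) addmC mpolyXD.
have -> : 'X_[U_(l)] = gl_form (1%:M : 'M[K]_n) l by rewrite -gl_actXU gl_act1.
by apply: PY => //; rewrite mdegBU // -du prednK // mdegE (bigD1 l) //= addn_gt0 ul.
Qed.

Lemma stable_counting d : stable_ideal I ->
  counting_data I d stable_norm (fun j u => u + U_(j))%MM.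
Proof.
case=> mI sI; split.
  move=> j u du /andP[/in_varsP vu /asboolP nI]; split; first by rewrite mdegDU du.
  case=> i zi; have [-> |ij] := eqVneq i j; first by rewrite addmK.
  have ui : (0 < u i)%N by move: zi; rewrite mnmDE mnm1E eq_sym (negPf ij) addn0.
  have lij : (i < j)%N.
    rewrite ltn_neqAle val_eqE ij leqNgt; apply/negP => /vu e.
    by rewrite e in ui.
  have -> : (u + U_(j) - U_(i) = u - U_(i) + U_(j))%MM.
    by rewrite -{1}(submUK ui) -addmA [(U_(i) + _)%MM]addmC addmA addmK.
  move=> Iv; apply: nI; rewrite -(submUK ui) -[(u - U_(i))%MM](addmK U_(j)%MM).
  have v0 : (0 < (u - U_(i) + U_(j))%MM j)%N by rewrite mnmDE mnm1E eqxx addn1.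
  apply: sI => //; first exact: mnm_ne0 v0.
  apply/is_max_varP; split=> // k jk; rewrite mnmDE mnmBE vu // !mnm1E.
  have /negPf-> : j != k by apply: contraTneq jk => ->; rewrite ltnn.
  by rewrite sub0n.
move=> j u j' u' _ /andP[/in_varsP vu _] _ /andP[/in_varsP vu' _] e.
have mx w (k : 'I_n) : (forall l : 'I_n, (k < l)%N -> w l = 0%N) -> is_max_var (w + U_(k)) k.
  move=> vw; apply/is_max_varP; split=> [|l kl]; first by rewrite mnmDE mnm1E eqxx addn1.
  rewrite mnmDE vw // mnm1E.
  by have /negPf-> : k != l by apply: contraTneq kl => ->; rewrite ltnn.
have ej : j = j' by apply: is_max_var_inj (mx _ _ vu) _; rewrite e; apply: mx.
by split=> //; move: e; rewrite ej => /addIm.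
Qed.

End Stable.

(** * Squarefree stable ideals *)

Section Squarefree.

Context (n : nat) (K : fieldType).
Implicit Types (u v w z : 'X_{1..n}) (i j l : 'I_n).

Lemma infinite_inj (hK : infinite_field K) m : exists a : 'I_m -> K, injective a.
Proof.
have [s us ss] : exists2 s : seq K, uniq s & size s = m.
  elim: m => [|m [s us ss]]; first by exists [::].
  by have [x xs] := hK s; exists (x :: s); rewrite /= ?xs ?ss.
exists (fun i : 'I_m => nth 0 s i) => x y /eqP; rewrite nth_uniq ?ss // => /eqP e.
exact: val_inj.
Qed.

(** The number of variables dividing [u] among the first [m] ones. *)
Definition rank u (m : nat) : nat := (\sum_(i < n | (i < m)%N) (0 < u i)%N)%N.
(** The number of variables dividing [u]. *)
Definition ssize u : nat := (\sum_(i < n) (0 < u i)%N)%N.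

Lemma rankS u i : rank u i.+1 = (rank u i + (0 < u i)%N)%N.
Proof.
rewrite /rank (bigD1 i) //= addnC; congr addn; apply: eq_bigl => k.
by rewrite ltnS ltn_neqAle andbC val_eqE.
Qed.

Lemma leq_rank u m m' : (m <= m')%N -> (rank u m <= rank u m')%N.
Proof.
move=> le; rewrite /rank [X in (_ <= X)%N](bigID (fun i : 'I_n => (i < m)%N)) /=.
apply: leq_trans (leq_addr _ _); apply: eq_leq; apply: eq_bigl => i.
by case: (ltnP i m) => [/leq_trans->|_]; rewrite ?andbF.
Qed.

Lemma rank_ltn u i (m : nat) : (0 < u i)%N -> (i < m)%N -> (rank u i < rank u m)%N.
Proof.
by move=> ui lt; apply: leq_trans (leq_rank u lt); rewrite rankS ui addn1.
Qed.

Lemma rank_inj u i i' : (0 < u i)%N -> (0 < u i')%N -> rank u i = rank u i' -> i = i'.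
Proof.
move=> ui ui' e; apply: val_inj => /=; have [lt|lt|//] := ltngtP i i'.
  by have := rank_ltn ui lt; rewrite e ltnn.
by have := rank_ltn ui' lt; rewrite e ltnn.
Qed.

Lemma rank_size u : rank u n = ssize u.
Proof. by apply: eq_bigl => i; rewrite ltn_ord. Qed.

Lemma rank_lt_size u i : (0 < u i)%N -> (rank u i < ssize u)%N.
Proof. by move=> ui; rewrite -rank_size; apply: rank_ltn => //; apply: ltn_ord. Qed.

Lemma ex_rank u c : (c < ssize u)%N -> exists2 b, (0 < u b)%N & rank u b = c.
Proof.
rewrite -rank_size => cn.
have ex : exists m, (c < rank u m)%N by exists n.
case: (ex_minnP ex) => -[|m]; first by rewrite /rank big_pred0.
move=> cm minm; have mn : (m < n)%N by apply: minm.
have := cm; rewrite (rankS u (Ordinal mn)) /=.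
have : (rank u m <= c)%N by rewrite leqNgt; apply/negP => /minm; rewrite ltnn.
move=> le; exists (Ordinal mn) => /=; lia.
Qed.

Lemma eq_rank u v : (forall k, (0 < u k)%N = (0 < v k)%N) -> rank u =1 rank v.
Proof. by move=> e m; apply: eq_bigr => k _; rewrite e. Qed.

Lemma ssize_le_mdeg u : (ssize u <= mdeg u)%N.
Proof. by rewrite mdegE; apply: leq_sum => k _; case: (u k). Qed.

Lemma squarefreeP u : reflect (forall i, u i <= 1)%N (squarefree u).
Proof. exact: forallP. Qed.

Lemma ssize_squarefree u : squarefree u -> ssize u = mdeg u.
Proof.
by move/squarefreeP=> sf; rewrite mdegE; apply: eq_bigr => k _; case: (u k) (sf k) => [|[]].
Qed.

Lemma pos_addU v i k : (0 < v i)%N -> (0 < (v + U_(i))%MM k)%N = (0 < v k)%N.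
Proof.
move=> vi; rewrite mnmDE mnm1E; case: eqP => [<-|_]; last by rewrite addn0.
by rewrite addn1 vi.
Qed.

Lemma sum_addU (Q : pred 'I_n) v i :
  (\sum_(k < n | Q k) (v + U_(i))%MM k = \sum_(k < n | Q k) v k + Q i)%N.
Proof.
under eq_bigr => k _ do rewrite mnmDE mnm1E.
rewrite big_split /=; congr addn; rewrite big_mkcond (bigD1 i) //= eqxx big1.
  by case: (Q i).
by move=> k /negPf ne; rewrite eq_sym ne if_same.
Qed.

Section Forms.

Context (a : 'I_n -> K) (aI : injective a).

(** The matrix sending [x_l] to the form with coefficients [a_i ^ (n - 1 - l)]. *)
Definition node_mx : 'M[K]_n := \matrix_(i, l) a i ^+ (n - l.+1).

Lemma node_mx_unit : node_mx \in unitmx.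
Proof.
have -> : node_mx = (row_perm (perm rev_ord_inj) (Vandermonde n (\row_i a i)))^T.
  by apply/matrixP=> i l; rewrite !mxE permE.
rewrite unitmx_tr row_permE unitmx_mul unitmx_perm /= unitmxE unitfE det_Vandermonde.
apply/prodf_neq0 => i _; apply/prodf_neq0 => k ik; rewrite !mxE subr_eq0.
by apply: contraTneq ik => /aI ->; rewrite ltnn.
Qed.

Context (d : nat) (j : 'I_n) (P : {mpoly K[n]} -> Prop).
Context (P0 : P 0).
Context (Plin : forall e x y, P x -> P y -> P (e *: x + y)).
Context (PY : forall l w, (j < l)%N -> (mdeg w).+1 = d -> P (gl_form node_mx l * 'X_[w])).

Let c := (n - j.+1)%N.

(** The images of the variables after [x_j] span all the forms whose coefficients
    are the values at the nodes of a polynomial with at most [c] coefficients. *)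
Lemma form_closed (p : {poly K}) w : (size p <= c)%N -> (mdeg w).+1 = d ->
  P ((\sum_(i < n) p.[a i] *: 'X_i) * 'X_[w]).
Proof.
move=> sp dw.
have -> : \sum_(i < n) p.[a i] *: 'X_i =
    \sum_(l < n | (j < l)%N) p`_(n - l.+1) *: gl_form node_mx l.
  rewrite /gl_form; under [RHS]eq_bigr => l _ do rewrite scaler_sumr.
  rewrite exchange_big /=; apply: eq_bigr => i _.
  under [RHS]eq_bigr => l _ do rewrite scalerA.
  rewrite -scaler_suml; congr (_ *: _).
  rewrite (@horner_coef_wide _ n); last by apply: leq_trans sp _; apply: leq_subr.
  rewrite (reindex_inj rev_ord_inj) /= [RHS]big_mkcond; apply: eq_bigr => l _.
  case: ltnP => [_|lj]; first by rewrite mxE.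
  rewrite nth_default ?mul0r //; apply: leq_trans sp _; rewrite /c; lia.
rewrite mulr_suml; elim/big_rec: _ => // l x jl Px.
by rewrite -scalerAl; apply: Plin => //; apply: PY.
Qed.

(** The polynomial used is the one with simple roots at the nodes indexed by [Z]. *)
Lemma exchange_closed (Z : {set 'I_n}) b v :
  (#|Z| < c)%N -> b \notin Z -> (mdeg v).+1 = d ->
  (forall i, i \notin Z -> i != b -> P 'X_[v + U_(i)]) -> P 'X_[v + U_(b)].
Proof.
move=> Zc bZ dv hP; pose p := \prod_(z <- enum Z) ('X - (a z)%:P).
have p0 i : (p.[a i] == 0) = (i \in Z).
  have -> : (p.[a i] == 0) = root p (a i) by [].
  rewrite /p -(big_map a xpredT (fun x => 'X - x%:P)) root_prod_XsubC.
  by rewrite (mem_map aI) mem_enum.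
have sp : (size p <= c)%N by rewrite size_prod_XsubC -cardE.
have := form_closed sp dv; rewrite mulr_suml (bigD1 b) //=.
under eq_bigr => i _ do rewrite -scalerAl mulrC -mpolyXD.
rewrite -scalerAl mulrC -mpolyXD; set r := \sum_(i | _) _ => Pf.
have Pr : P r.
  rewrite /r; elim/big_rec: _ => // i x ib Px; have [iZ|iZ] := boolP (i \in Z).
    by move: iZ; rewrite -p0 => /eqP ->; rewrite scale0r add0r.
  by apply: Plin => //; apply: hP.
have pb : p.[a b] != 0 by rewrite p0.
have Pfr := Plin (-1) Pr Pf; rewrite scaleN1r addrCA addNr addr0 in Pfr.
have := Plin (p.[a b])^-1 Pfr P0.
by rewrite addr0 scalerA mulVf // scale1r.
Qed.

End Forms.

Context (I : {mpoly K[n]} -> Prop).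

(** The set [T j] for a squarefree stable ideal: monomials outside [I] whose
    repeated variables are preceded by at least [n - 1 - j] variables of the
    support, and which involve only the first [j + d] variables. *)
Definition sqfree_norm d j u : bool :=
  [&& ~~ `[< I 'X_[u] >],
      [forall i : 'I_n, (1 < u i)%N ==> (n - j.+1 <= rank u i)%N] &
      [forall i : 'I_n, (0 < u i)%N ==> (i < j + d)%N]].

Lemma sqfree_normP d j u :
  reflect [/\ ~ I 'X_[u], forall i, (1 < u i)%N -> (n - j.+1 <= rank u i)%N
            & forall i, (0 < u i)%N -> (i < j + d)%N]
          (sqfree_norm d j u).
Proof.
apply: (iffP and3P) => -[h1 h2 h3]; split.
- exact/asboolPn.
- by move=> i; move/forallP: h2 => /(_ i)/implyP.
- by move=> i; move/forallP: h3 => /(_ i)/implyP.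
- exact/asboolPn.
- by apply/forallP=> i; apply/implyP/h2.
- by apply/forallP=> i; apply/implyP/h3.
Qed.

Lemma card_low_rank u c : (#|[set i : 'I_n | (0 < u i)%N && (rank u i < c)%N]| <= c)%N.
Proof.
case: c => [|c]; first by rewrite leqn0 cards_eq0; apply/eqP/setP => i; rewrite !inE andbF.
rewrite -[X in (_ <= X)%N]card_ord.
rewrite -(card_in_imset (f := fun i : 'I_n => inord (rank u i) : 'I_c.+1)).
  exact: max_card.
move=> i i'; rewrite !inE => /andP[ui ri] /andP[ui' ri'] /(congr1 val) /=.
by rewrite !inordK //; apply: rank_inj.
Qed.

Lemma sqfree_spanning a d : injective a -> spanning_data I d (node_mx a) (sqfree_norm d).
Proof.
move=> aI; split=> [|j P P0 Plin PT PI PY]; first exact: node_mx_unit.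
pose c := (n - j.+1)%N.
have exch := exchange_closed aI P0 Plin PY.
have PN u : mdeg u = d -> (forall i, (1 < u i)%N -> (c <= rank u i)%N) ->
    (forall i, (0 < u i)%N -> (i < j + d)%N) -> P 'X_[u].
  move=> du h1 h2; have [Iu|nI] := pselect (I 'X_[u]); first exact: PI.
  by apply: PT => //; apply/sqfree_normP.
(* A variable beyond the first [j + d] is exchanged for earlier ones outside the
   support, so the number of such variables drops. *)
have PS u : squarefree u -> mdeg u = d -> P 'X_[u].
  pose wt u := (\sum_(k < n | (j + d <= k)%N) u k)%N.
  move: {2}(wt u) (leqnn (wt u)) => m; elim: m u => [|m IHm] u.
    move=> + sf du; rewrite leqn0 sum_nat_eq0 => /forall_inP h; apply: PN => //.
      by move=> i; rewrite ltnNge (squarefreeP _ sf).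
    by move=> i ui; rewrite ltnNge; apply/negP => /h /eqP e; rewrite e in ui.
  move=> wu sf du; have sf' := squarefreeP _ sf.
  have [/existsP[b /andP[jb ub]]|nb] := boolP [exists b : 'I_n, (j + d <= b)%N && (0 < u b)%N]; last first.
    apply: PN => // [i|i ui]; first by rewrite ltnNge sf'.
    by move: nb; rewrite negb_exists => /forallP/(_ i); rewrite ui andbT -ltnNge.
  have bn := ltn_ord b.
  pose v := (u - U_(b))%MM; have eu : u = (v + U_(b))%MM by rewrite submUK.
  have dv : (mdeg v).+1 = d by rewrite -(mdegDU v b) -eu.
  rewrite eu; apply: (exch ([set i : 'I_n | (j + d <= i)%N] :\ b :|: [set i | (0 < u i)%N] :\ b)) => //.
  (* There are [n - (j + d)] indices from [j + d] on and [d] indices in the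
     support; [b] is in both sets and removed from both, which leaves at most
     [n - j - 2] indices in the union. *)
  - have c1 : #|[set i : 'I_n | (j + d <= i)%N]| = (n - (j + d))%N.
      have := cardsC [set i : 'I_n | (i < j + d)%N]; rewrite card_ord.
      have -> : ~: [set i : 'I_n | (i < j + d)%N] = [set i : 'I_n | (j + d <= i)%N].
        by apply/setP=> i; rewrite !inE -leqNgt.
      have -> : #|[set i : 'I_n | (i < j + d)%N]| = (j + d)%N; last by lia.
      rewrite -sum1dep_card -(big_ord_widen n (fun=> 1%N)) ?sum1_card ?card_ord //.
      lia.
    have c2 : #|[set i : 'I_n | (0 < u i)%N]| = d.
      rewrite -du -(ssize_squarefree sf) /ssize -sum1dep_card big_mkcond.
      by apply: eq_bigr => i _; case: (0 < u i)%N.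
    move: (cardsD1 b [set i : 'I_n | (j + d <= i)%N]); rewrite c1 inE jb.
    move: (cardsD1 b [set i : 'I_n | (0 < u i)%N]); rewrite c2 inE ub.
    set A := _ :\ b; set B := _ :\ b => eA eB.
    have [le _] := leq_card_setU B A; apply: leq_ltn_trans le _.
    move: (jb : (j + d <= val b)%N) bn eA eB => /=.
    move: #|A| #|B| => x y; lia.
  - by rewrite !inE eqxx.
  move=> i; rewrite !inE negb_or !negb_and !negbK => /andP[+ +] ib; rewrite (negPf ib) /=.
  rewrite -ltnNge -leqNgt leqn0 => ij /eqP ui.
  apply: IHm; last by rewrite mdegDU.
    move: wu; rewrite eu /wt !sum_addU jb leqNgt; case: leqP ij => //; lia.
  apply/squarefreeP => k; rewrite mnmDE mnmBE !mnm1E; have [<-|_] := eqVneq i k; first by rewrite ui sub0n.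
  by rewrite addn0; apply: leq_trans (leq_subr _ _) (sf' k).
(* A repeated variable of rank less than [c] is exchanged either for variables
   outside the support, which enlarges it, or for variables of the support of
   rank at least [c], which lowers the total exponent [wt] of the others. *)
move=> u; move: {2}(n - ssize u)%N (erefl (n - ssize u)%N) => m.
elim/ltn_ind: m u => m IHm u.
pose wt u := (\sum_(k < n | (rank u k < c)%N) u k)%N.
move: {2}(wt u) (erefl (wt u)) => m'; elim/ltn_ind: m' u => m' IHm' u wu su du.
have [sf|] := boolP (squarefree u); first exact: PS.
rewrite negb_forall => /existsP[b0]; rewrite -ltnNge => ub0.
have [/existsP[b /andP[ub rb]]|nb] := boolP [exists b, (1 < u b)%N && (rank u b < c)%N]; last first.
  have h1 i : (1 < u i)%N -> (c <= rank u i)%N.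
    by move=> ui; move: nb; rewrite negb_exists => /forallP/(_ i); rewrite ui -leqNgt.
  apply: PN => // i _; rewrite ltnNge; apply/negP => ji.
  have := h1 _ ub0; have := rank_lt_size (ltnW ub0); have := ssize_le_mdeg u.
  have := ltn_ord i; rewrite /c; lia.
pose v := (u - U_(b))%MM; have eu : u = (v + U_(b))%MM by rewrite submUK // ltnW.
have dv : (mdeg v).+1 = d by rewrite -(mdegDU v b) -eu.
have vb : (0 < v b)%N by rewrite mnmBE mnm1E eqxx subn_gt0.
have posv k : (0 < u k)%N = (0 < v k)%N by rewrite eu pos_addU.
rewrite eu; apply: (exch ([set i : 'I_n | (0 < u i)%N && (rank u i < c)%N] :\ b)) => //.
- move: (cardsD1 b [set i : 'I_n | (0 < u i)%N && (rank u i < c)%N]).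
  rewrite inE rb (ltnW ub) /= => e; move: (card_low_rank u c); rewrite e; exact.
- by rewrite !inE eqxx.
move=> i; rewrite !inE negb_and negb_and negbK => + ib; rewrite (negPf ib) /=.
rewrite -leqNgt leqn0 -leqNgt => uri.
have [vi|vi] := posnP (v i).
  have ui : u i = 0%N by apply/eqP; rewrite -leqn0 leqNgt posv vi.
  have szv : ssize (v + U_(i))%MM = (ssize u).+1.
    rewrite /ssize (bigD1 i) //= [in RHS](bigD1 i) //= mnmDE mnm1E eqxx addn1 ui vi.
    rewrite add1n; congr _.+1; apply: eq_bigr => k ki.
    by rewrite mnmDE mnm1E eq_sym (negPf ki) addn0 posv.
  apply: (IHm (n - ssize (v + U_(i))%MM)%N); rewrite ?mdegDU //.
  have : (ssize (v + U_(i))%MM <= n)%N.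
    by rewrite -[X in (_ <= X)%N]card_ord -sum1_card; apply: leq_sum => k _; apply: leq_b1.
  rewrite -su szv; lia.
have {}uri : (c <= rank u i)%N by case/orP: uri => // /eqP ui; rewrite -posv ui in vi.
have rk : rank (v + U_(i))%MM =1 rank u.
  by apply: eq_rank => k; rewrite pos_addU // posv.
have szu : ssize (v + U_(i))%MM = ssize u by rewrite -!rank_size rk.
apply: (IHm' (wt (v + U_(i))%MM)); rewrite ?szu ?mdegDU //.
have wtE l : rank (v + U_(l))%MM =1 rank u ->
    wt (v + U_(l))%MM = (\sum_(k < n | (rank u k < c)%N) v k + (rank u l < c)%N)%N.
  move=> rl; rewrite /wt; under eq_bigl => k do rewrite rl.
  exact: (sum_addU (fun k : 'I_n => (rank u k < c)%N)).
have := wtE b; rewrite -eu => /(_ (fun=> erefl)); rewrite wu rb => ->.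
by rewrite wtE // [(rank u i < c)%N]ltnNge uri addn0 addn1.
Qed.

(** The injection for a squarefree stable ideal.  Both default values [j] are
    unused when [u] is of degree [d] and in [sqfree_norm d j]: a
    variable of the required rank
    exists in the first case, and [j + d < n] in the second. *)
Definition sqfree_shift d j u : 'X_{1..n} :=
  if (n - j.+1 < ssize u)%N
  then (u + U_(odflt j [pick b | (0 < u b)%N && (rank u b == n - j.+1)%N]))%MM
  else (u + U_(insubd j (j + d)%N))%MM.

(** In the second case all the variables of the support have rank less than
    [n - 1 - j], so none is repeated. *)
Lemma sqfree_shiftP d j u : mdeg u = d -> sqfree_norm d j u ->
  (exists b, [/\ (0 < u b)%N, rank u b = (n - j.+1)%N & sqfree_shift d j u = (u + U_(b))%MM]) \/
  (squarefree u /\ exists m : 'I_n, [/\ m = (j + d)%N :> nat,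
     forall i, (0 < u i)%N -> (i < m)%N & sqfree_shift d j u = (u + U_(m))%MM]).
Proof.
move=> du /sqfree_normP[_ h1 h2]; rewrite /sqfree_shift; case: ltnP => [lt|le].
  left; case: pickP => [b /andP[ub /eqP rb]|nb] /=; first by exists b.
  by have [b ub rb] := ex_rank lt; have := nb b; rewrite ub rb eqxx.
have sf : squarefree u.
  apply/squarefreeP=> i; rewrite leqNgt; apply/negP=> ui.
  by have := h1 _ ui; have := rank_lt_size (ltnW ui); lia.
have jd : (j + d < n)%N.
  have := ssize_squarefree sf; rewrite du => e; have := ltn_ord j; lia.
right; split=> //; exists (insubd j (j + d)%N).
have e : insubd j (j + d)%N = (j + d)%N :> nat by rewrite val_insubd jd.
by split=> // i /h2; rewrite e.
Qed.

(** Membership of a monomial in a squarefree monomial ideal depends only on its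
    support, and monotonically. *)
Lemma sqfree_monomialX u v : squarefree_monomial_ideal I ->
  (forall k, (0 < u k)%N -> (0 < v k)%N) -> I 'X_[u] -> I 'X_[v].
Proof.
case=> M Msf IM uv; rewrite !IM !monomial_spanXP => -[w Mw /mnm_lepP wu].
exists w => //; apply/mnm_lepP=> k; have := squarefreeP _ (Msf _ Mw) k.
by have := wu k; have := uv k; lia.
Qed.

Lemma sqfree_monomial_ideal : squarefree_monomial_ideal I -> monomial_ideal I.
Proof. by case=> M _ IM; exists M. Qed.

Lemma sqfree_counting d : squarefree_stable_ideal I ->
  counting_data I d (sqfree_norm d) (sqfree_shift d).
Proof.
case=> mI sI; split.
  move=> j u du Tu; have /sqfree_normP[nI _ _] := Tu.
  case: (sqfree_shiftP du Tu) => [[b [ub rb ->]]|[sf [m [em um ->]]]].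
    rewrite mdegDU du; split=> //; case=> i zi Iz; apply: nI.
    apply: sqfree_monomialX mI _ Iz => k; rewrite mnmBE => zk.
    by rewrite -(pos_addU k ub); lia.
  rewrite mdegDU du; split=> //; case=> i zi.
  have [-> |im] := eqVneq i m; first by rewrite addmK.
  have ui : (0 < u i)%N by move: zi; rewrite mnmDE mnm1E eq_sym (negPf im) addn0.
  have lim := um _ ui; have sfu := squarefreeP _ sf.
  have u0 : u m = 0%N.
    by apply/eqP; rewrite -leqn0 leqNgt; apply/negP => /um; rewrite ltnn.
  have -> : (u + U_(m) - U_(i) = u - U_(i) + U_(m))%MM.
    by rewrite -{1}(submUK ui) -addmA [(U_(i) + _)%MM]addmC addmA addmK.
  move=> Iv; apply: nI; rewrite -(submUK ui) -[(u - U_(i))%MM](addmK U_(m)%MM).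
  have v0 : (0 < (u - U_(i) + U_(m))%MM m)%N by rewrite mnmDE mnm1E eqxx addn1.
  apply: sI => //.
  - apply/squarefreeP=> k; rewrite mnmDE mnmBE !mnm1E.
    have [<-|_] := eqVneq m k; first by rewrite u0 sub0n.
    by rewrite addn0; apply: leq_trans (leq_subr _ _) (sfu k).
  - exact: mnm_ne0 v0.
  - apply/is_max_varP; split=> // k mk; rewrite mnmDE mnmBE !mnm1E.
    have /negPf-> : m != k by apply: contraTneq mk => ->; rewrite ltnn.
    have -> : u k = 0%N; last by rewrite sub0n.
    by apply/eqP; rewrite -leqn0 leqNgt; apply/negP => /um; rewrite ltnNge ltnW.
  rewrite mnmDE mnmBE !mnm1E eqxx eq_sym (negPf im) addn0.
  by have := sfu i; lia.
move=> j u j' u' du Tu du' Tu'.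
have subj (k k' : 'I_n) : (n - k.+1 = n - k'.+1)%N -> k = k'.
  move=> e; apply: val_inj => /=; have := ltn_ord k; have := ltn_ord k'; lia.
(* In the first case the product has a repeated variable, in the second it is
   squarefree, so the two cases do not meet. *)
have nosf w b : (0 < w b)%N -> (1 < (w + U_(b))%MM b)%N.
  by move=> wb; rewrite mnmDE mnm1E eqxx addn1 ltnS.
have sfm w (m : 'I_n) : squarefree w -> (forall i, (0 < w i)%N -> (i < m)%N) ->
    forall k, ((w + U_(m))%MM k <= 1)%N.
  move=> /squarefreeP sf wm k; rewrite mnmDE mnm1E.
  have [<-|_] := eqVneq m k; last by rewrite addn0.
  have -> : w m = 0%N; last by [].
  by apply/eqP; rewrite -leqn0 leqNgt; apply/negP => /wm; rewrite ltnn.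
case: (sqfree_shiftP du Tu) => [[b [ub rb ->]]|[sf [m [em um ->]]]];
  case: (sqfree_shiftP du' Tu') => [[b' [ub' rb' ->]]|[sf' [m' [em' um' ->]]]] e.
- have rkz : rank u =1 rank u'.
    by move=> k; apply: eq_rank => l; rewrite -(pos_addU l ub) e pos_addU.
  (* The number [n - 1 - j] is the least rank of a repeated variable of the
     product. *)
  have half (k k' : 'I_n) w w' i i' : (0 < w i)%N -> rank w i = (n - k.+1)%N ->
      rank w' i' = (n - k'.+1)%N -> sqfree_norm d k' w' -> rank w =1 rank w' ->
      (w + U_(i) = w' + U_(i'))%MM -> (n - k'.+1 <= n - k.+1)%N.
    move=> wi ri ri' /sqfree_normP[_ h _] rk ee; rewrite -ri rk.
    have [<-|ne] := eqVneq i' i; first by rewrite ri'.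
    apply: h; have := nosf _ _ wi.
    by rewrite ee mnmDE mnm1E (negPf ne) addn0.
  have ej : j = j'.
    apply: subj; apply/eqP; rewrite eqn_leq.
    rewrite (half _ _ _ _ _ _ ub' rb' rb Tu _ (esym e)) => [|k]; last by rewrite rkz.
    by rewrite (half _ _ _ _ _ _ ub rb rb' Tu' rkz e).
  have eb : b = b'.
    apply: (rank_inj ub); first by rewrite -(pos_addU b' ub) e pos_addU.
    by rewrite rb rkz rb' ej.
  by split=> //; move: e; rewrite eb => /addIm.
- by have := sfm _ _ sf' um' b; rewrite -e leqNgt nosf.
- by have := sfm _ _ sf um b'; rewrite e leqNgt nosf.
have emm : m = m'.
  have mx w (k : 'I_n) : (forall i, (0 < w i)%N -> (i < k)%N) -> is_max_var (w + U_(k)) k.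
    move=> wk; apply/is_max_varP; split=> [|l kl]; first by rewrite mnmDE mnm1E eqxx addn1.
    rewrite mnmDE mnm1E.
    have /negPf-> : k != l by apply: contraTneq kl => ->; rewrite ltnn.
    by rewrite addn0; apply/eqP; rewrite -leqn0 leqNgt; apply/negP => /wk; rewrite ltnNge ltnW.
  by apply: is_max_var_inj (mx _ _ um) _; rewrite e; apply: mx.
have ej : j = j'.
  by apply: val_inj; have := congr1 val emm; rewrite /= em em'; apply: addIn.
by split=> //; move: e; rewrite emm => /addIm.
Qed.

End Squarefree.

(** * Stability of the generic initial ideal *)

Theorem proposition1p2 (K : fieldType) (hK : infinite_field K) (n : nat)
    (I : {mpoly K[n]} -> Prop)
    (hI : stable_ideal I \/ squarefree_stable_ideal I)
    (Gin : {mpoly K[n]} -> Prop)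
    (hGin : is_generic_initial_ideal I Gin) :
  stable_ideal Gin.
Proof.
split.
  have [U [_ [g Ug] GinU]] := hGin.
  by exists (init_mon (gl_image g I)) => f; rewrite -(GinU g Ug).
move=> u Gu _; case: hI => [sI|sI].
  have [mI _] := sI.
  exact: (stable_criterion hK mI (stable_spanning I (mdeg u)) (stable_counting _ sI) hGin).
have [/sqfree_monomial_ideal mI _] := sI; have [a aI] := infinite_inj hK n.
exact: (stable_criterion hK mI (sqfree_spanning I (mdeg u) aI) (sqfree_counting _ sI) hGin).
Qed.
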